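(* Let $m\ge 0$ be an integer and let $p,P,r,R$ be real sequences on $\mathbb{Z}_m=\{k\in\mathbb{Z}:k\ge m\}$ with $P_k\ge p_k\ge 0$ and $0<R_k\le r_k$ for all $k\in\mathbb{Z}_m$. Consider the linear difference equations $$\Delta(r_k\Delta y_k)+p_ky_{k+1}=0\qquad (A)$$ and $$\Delta(R_k\Delta x_k)+P_kx_{k+1}=0,\qquad (B)$$ where (B) is nonoscillatory. Let $x$ be a positive solution of (B) on $\mathbb{Z}_m$ (i.e. $x_k>0$ for all $k\in\mathbb{Z}_m$). Then there is a recessive solution $u$ of (A) which is positive on $\mathbb{Z}_m$ and satisfies $$\frac{r_k\Delta u_k}{u_k}\le\frac{R_k\Delta x_k}{x_k}\quad\text{for all }k\in\mathbb{Z}_m.$$ In addition, if $x$ is decreasing (respectively, nonincreasing) on $\mathbb{Z}_m$, then $u$ is decreasing (respectively, nonincreasing) on $\mathbb{Z}_m$.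
   Context: $\Delta x_k=x_{k+1}-x_k$. A solution of such an equation on $\mathbb{Z}_m$ is a real sequence on $\mathbb{Z}_m$ satisfying the equation for every $k\in\mathbb{Z}_m$. ''Decreasing'' means $\Delta x_k<0$ for all $k$ and ''nonincreasing'' means $\Delta x_k\le 0$ for all $k$. A nontrivial solution $y$ is nonoscillatory if $y_ky_{k+1}>0$ for all large $k$; an equation is nonoscillatory if all its nontrivial solutions are nonoscillatory (equivalently, if it has one nonoscillatory solution). If (B) is nonoscillatory, then so is (A). For a nonoscillatory equation, a recessive solution is a nontrivial solution $u$ (unique up to a constant factor) such that $\lim_{k\to\infty}u_k/y_k=0$ for every solution $y$ linearly independent of $u$. *)

(* Defs.v *)
(* Stdlib reals, with Coquelicot for limits of sequences. *)
From Stdlib Require Export Reals.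
From Coquelicot Require Export Coquelicot.
Open Scope R_scope.

(* A real sequence on Z_m = {k in Z : k >= m}, with m >= 0, is encoded as a total
   function nat -> R; only its values at indices k >= m matter, so every
   notion below relativizes its quantifiers to k >= m. *)

Definition fdiff (x : nat -> R) (k : nat) : R := x (S k) - x k.

Definition is_solution (m : nat) (r p y : nat -> R) : Prop :=
  forall k : nat, (m <= k)%nat ->
    fdiff (fun j : nat => r j * fdiff y j) k + p k * y (S k) = 0.

Definition nontrivial (m : nat) (y : nat -> R) : Prop :=
  exists k : nat, (m <= k)%nat /\ y k <> 0.

Definition nonosc_seq (y : nat -> R) : Prop :=
  exists N : nat, forall k : nat, (N <= k)%nat -> 0 < y k * y (S k).

Definition nonosc_eq (m : nat) (r p : nat -> R) : Prop :=
  forall y : nat -> R,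
    is_solution m r p y -> nontrivial m y -> nonosc_seq y.

Definition lin_indep (m : nat) (u y : nat -> R) : Prop :=
  forall a b : R,
    (forall k : nat, (m <= k)%nat -> a * u k + b * y k = 0) -> a = 0 /\ b = 0.

(* Recessive solutions are defined for nonoscillatory equations only, hence the
   first conjunct; it makes y k <> 0 for all large k, so that the value
   of the total division at 0 plays no role in the limit. *)
Definition recessive (m : nat) (r p u : nat -> R) : Prop :=
  nonosc_eq m r p /\
  is_solution m r p u /\
  nontrivial m u /\
  (forall y : nat -> R,
     is_solution m r p y -> lin_indep m u y ->
     is_lim_seq (fun k : nat => u k / y k) 0).

Definition positive_on (m : nat) (x : nat -> R) : Prop :=
  forall k : nat, (m <= k)%nat -> 0 < x k.

Definition decreasing_on (m : nat) (x : nat -> R) : Prop :=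
  forall k : nat, (m <= k)%nat -> fdiff x k < 0.

Definition nonincreasing_on (m : nat) (x : nat -> R) : Prop :=
  forall k : nat, (m <= k)%nat -> fdiff x k <= 0.

(* Main.v *)
Require Import Defs.
From Stdlib Require Import Reals Lra Lia.
From Coquelicot Require Import Coquelicot.
Open Scope R_scope.

(** Two ingredients carry the proof.

    The first is the Riccati comparison.  For a positive solution the quotient
    [w k = R k * fdiff x k / x k] satisfies
    [w (k+1) = R k * w k / (R k + w k) - P k], and the right-hand side is
    increasing in [w], nondecreasing in [R] and decreasing in [P], as long as
    [R k + w k > 0], which says that [x (k+1)] is positive.  Hence a solution of the
    equation with larger [r] and smaller [p] that starts at some index with a
    positive value and a quotient at least that of [x] stays positive and keeps
    this order from then on ([comparison_forward]).

    The second is d'Alembert's reduction of order.  If [y] is a positive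
    solution and [S] a sum of [1 / (r k * y k * y (k+1))], the solutions are
    exactly [y * (a + c * S)].  As [S] is strictly increasing, the equation is
    nonoscillatory ([positive_solution_nonosc]), and a recessive solution is
    visible: [y * (L - S)] if [S] tends to a finite [L], and [y] itself if [S]
    tends to infinity.  Either is positive wherever [y] is
    ([positive_recessive_exists]).

    The comparison provides such a [y] for (A): start it at [m] with the
    quotient of [x].  Let [u] be the resulting recessive solution.  If its
    quotient exceeded that of [x] at an index [N], let [z] be the solution with
    [z N = u N] and the quotient of [x] at [N].  Then [z] is positive from [N]
    on, and by constancy of the Casoratian [u / z] increases from the value 1
    at [N], whereas it tends to 0 by recessiveness ([recessive_fdiff_le],
    [recessive_quotient_le]).  The statements on monotonicity follow, since
    the sign of the quotient is that of the difference. *)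

(** * Solutions, initial values and the Casoratian *)

Lemma is_solution_step m r p y k :
  is_solution m r p y -> (m <= k)%nat ->
  r (S k) * fdiff y (S k) = r k * fdiff y k - p k * y (S k).
Proof.
  intros H Hk. generalize (H k Hk). unfold fdiff at 1. lra.
Qed.

Lemma fdiff_succ y k : y (S k) = y k + fdiff y k.
Proof. unfold fdiff. ring. Qed.

Lemma is_solution_lincomb m r p y z a b :
  is_solution m r p y -> is_solution m r p z ->
  is_solution m r p (fun k => a * y k + b * z k).
Proof.
  intros Hy Hz k Hk.
  generalize (Hy k Hk) (Hz k Hk). unfold fdiff. intros E1 E2.
  transitivity
    (a * (r (S k) * (y (S (S k)) - y (S k)) - r k * (y (S k) - y k)
          + p k * y (S k))
     + b * (r (S k) * (z (S (S k)) - z (S k)) - r k * (z (S k) - z k)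
            + p k * z (S k))).
  - ring.
  - rewrite E1, E2. ring.
Qed.

(** The pair of the value and of [r * fdiff y] at index [m + i], as a
    first-order system. *)
Fixpoint trajectory (m : nat) (r p : nat -> R) (a b : R) (i : nat) : R * R :=
  match i with
  | O => (a, b)
  | S i' =>
      let (y, q) := trajectory m r p a b i' in
      let y' := y + q / r (m + i')%nat in
      (y', q - p (m + i')%nat * y')
  end.

Lemma solution_with_initial_data m r p a b :
  (forall k, (m <= k)%nat -> r k <> 0) ->
  exists y, is_solution m r p y /\ y m = a /\ r m * fdiff y m = b.
Proof.
  intros Hr.
  set (t := trajectory m r p a b).
  assert (Hstep : forall k, (m <= k)%nat ->
    fst (t (S k - m)%nat) = fst (t (k - m)%nat) + snd (t (k - m)%nat) / r k /\
    snd (t (S k - m)%nat)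
      = snd (t (k - m)%nat) - p k * fst (t (S k - m)%nat)).
  { intros k Hk. replace (S k - m)%nat with (S (k - m)) by lia.
    generalize (Nat.sub_add m k Hk). rewrite Nat.add_comm.
    generalize (k - m)%nat. intros i <-. unfold t. simpl.
    destruct (trajectory m r p a b i) as [y q]. simpl. auto. }
  assert (Hq : forall k, (m <= k)%nat ->
    r k * fdiff (fun k => fst (t (k - m)%nat)) k = snd (t (k - m)%nat)).
  { intros k Hk. unfold fdiff. rewrite (proj1 (Hstep k Hk)).
    field. apply Hr, Hk. }
  exists (fun k => fst (t (k - m)%nat)). repeat split.
  - intros k Hk. unfold fdiff at 1.
    rewrite !Hq by lia. rewrite (proj2 (Hstep k Hk)). ring.
  - replace (m - m)%nat with 0%nat by lia. reflexivity.
  - rewrite Hq by lia. replace (m - m)%nat with 0%nat by lia. reflexivity.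
Qed.

(** The recurrence can also be solved backwards, so the data may be prescribed
    at any index of the domain. *)
Lemma solution_with_data_at m r p N a b :
  (forall k, (m <= k)%nat -> r k <> 0) -> (m <= N)%nat ->
  exists y, is_solution m r p y /\ y N = a /\ r N * fdiff y N = b.
Proof.
  intros Hr HN. revert a b. induction HN as [|N HN IH]; intros a b.
  - now apply solution_with_initial_data.
  - destruct (IH (a - (b + p N * a) / r N) (b + p N * a)) as (y & Hy & Ha & Hb).
    assert (HS : y (S N) = a).
    { rewrite fdiff_succ, Ha.
      replace (fdiff y N) with ((b + p N * a) / r N).
      - ring.
      - rewrite <- Hb. field. apply Hr, HN. }
    exists y. repeat split; auto.
    rewrite (is_solution_step _ _ _ _ _ Hy HN), Hb, HS. ring.
Qed.

Lemma casoratian_constant m r p y z N k :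
  is_solution m r p y -> is_solution m r p z -> (m <= N)%nat -> (N <= k)%nat ->
  r k * (y k * fdiff z k - z k * fdiff y k)
  = r N * (y N * fdiff z N - z N * fdiff y N).
Proof.
  intros Hy Hz HN Hk. induction Hk as [|k Hk IH]; [reflexivity|].
  rewrite <- IH.
  transitivity (y (S k) * (r (S k) * fdiff z (S k))
                - z (S k) * (r (S k) * fdiff y (S k))); [ring|].
  rewrite (is_solution_step _ _ _ y k Hy), (is_solution_step _ _ _ z k Hz)
    by lia.
  rewrite (fdiff_succ y k), (fdiff_succ z k). ring.
Qed.

(** * Riccati comparison *)

(** One step of the comparison, with [q = r * fdiff y] and [Q = R * fdiff x];
    the order of the quotients [q / y] and [Q / x] is written without
    division. *)
Lemma comparison_step r R p P y q x Q :
  0 < R -> R <= r -> p <= P ->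
  0 < y -> 0 < x -> 0 < x + Q / R -> y * Q <= q * x ->
  0 < y + q / r /\
  (y + q / r) * (Q - P * (x + Q / R)) <= (q - p * (y + q / r)) * (x + Q / R).
Proof.
  intros HR Hr Hp Hy Hx Hx' H.
  set (i := / r). set (I := / R).
  assert (Hi : 0 < i) by (apply Rinv_0_lt_compat; lra).
  assert (HiI : i <= I) by (apply Rinv_le_contravar; lra).
  unfold Rdiv in *. fold i. fold I in Hx'. fold I.
  assert (Hy' : 0 < y + q * i).
  { destruct (Rle_or_lt 0 q) as [Hq|Hq].
    - assert (0 <= q * i) by (apply Rmult_le_pos; lra). lra.
    - assert (q * I <= q * i) by (apply Rmult_le_compat_neg_l; lra).
      assert (0 < y * (x + Q * I)) by (apply Rmult_lt_0_compat; lra).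
      assert (y * Q * I <= q * x * I) by (apply Rmult_le_compat_r; lra).
      assert (0 < x * (y + q * I)) by lra.
      assert (0 < y + q * I).
      { apply Rmult_lt_reg_l with x; lra. }
      lra. }
  split; [exact Hy'|].
  assert (Hyx : 0 < (y + q * i) * (x + Q * I)) by (apply Rmult_lt_0_compat; lra).
  assert (p * ((y + q * i) * (x + Q * I)) <= P * ((y + q * i) * (x + Q * I)))
    by (apply Rmult_le_compat_r; lra).
  enough ((y + q * i) * Q <= q * (x + Q * I)) by lra.
  destruct (Rle_or_lt 0 (q * Q)) as [HqQ|HqQ].
  - assert (q * Q * i <= q * Q * I) by (apply Rmult_le_compat_l; lra). lra.
  - (* Opposite signs: the order of the quotients leaves only Q < 0 < q. *)
    assert (Hq : 0 < q).
    { destruct (Rle_or_lt q 0) as [Hq|Hq]; [|lra]. exfalso.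
      assert (0 < Q) by nra. nra. }
    assert (Q < 0) by nra.
    assert (0 < q * (x + Q * I)) by (apply Rmult_lt_0_compat; lra).
    assert ((y + q * i) * Q < 0) by nra.
    lra.
Qed.

Lemma comparison_forward m pA pB rA rB x y N :
  (forall k, (m <= k)%nat -> pA k <= pB k) ->
  (forall k, (m <= k)%nat -> 0 < rB k /\ rB k <= rA k) ->
  is_solution m rB pB x -> positive_on m x ->
  is_solution m rA pA y -> (m <= N)%nat ->
  0 < y N -> y N * (rB N * fdiff x N) <= rA N * fdiff y N * x N ->
  positive_on N y.
Proof.
  intros Hp Hr Hx Hxpos Hy HN HyN HqN k Hk.
  enough (0 < y k /\ y k * (rB k * fdiff x k) <= rA k * fdiff y k * x k)
    by tauto.
  induction Hk as [|k Hk [IH1 IH2]]; [auto|].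
  assert (Hmk : (m <= k)%nat) by lia.
  destruct (Hr k Hmk) as [HR Hrk].
  assert (Ex : x (S k) = x k + rB k * fdiff x k / rB k)
    by (rewrite fdiff_succ; field; lra).
  assert (Ey : y (S k) = y k + rA k * fdiff y k / rA k)
    by (rewrite fdiff_succ; field; lra).
  rewrite (is_solution_step _ _ _ _ _ Hx Hmk),
    (is_solution_step _ _ _ _ _ Hy Hmk), Ex, Ey.
  apply comparison_step; auto.
  rewrite <- Ex. apply Hxpos. lia.
Qed.

(** * Reduction of order *)

(** Only the increments at indices of the domain matter; starting the sum at 0
    rather than at the first index of the domain adds a constant. *)
Fixpoint dalembert_sum (r y : nat -> R) (k : nat) : R :=
  match k with
  | O => 0
  | S j => dalembert_sum r y j + / (r j * y j * y (S j))
  end.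

Lemma dalembert_sum_lt m r y k :
  (forall k, (m <= k)%nat -> 0 < r k) -> positive_on m y -> (m <= k)%nat ->
  dalembert_sum r y k < dalembert_sum r y (S k).
Proof.
  intros Hr Hy Hk. simpl.
  enough (0 < / (r k * y k * y (S k))) by lra.
  apply Rinv_0_lt_compat.
  repeat apply Rmult_lt_0_compat; auto.
Qed.

Lemma dalembert_sum_le m r y j k :
  (forall k, (m <= k)%nat -> 0 < r k) -> positive_on m y ->
  (m <= j)%nat -> (j <= k)%nat ->
  dalembert_sum r y j <= dalembert_sum r y k.
Proof.
  intros Hr Hy Hj Hk. induction Hk as [|k Hk IH]; [lra|].
  assert (dalembert_sum r y k < dalembert_sum r y (S k))
    by (apply (dalembert_sum_lt m); auto; lia).
  lra.
Qed.

(** [r * fdiff (y * S) = (r * fdiff y) * S + 1 / y], and the second term makes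
    up for the increment of [S] when the first is differenced again. *)
Lemma dalembert_solution m r p y :
  (forall k, (m <= k)%nat -> 0 < r k) -> positive_on m y ->
  is_solution m r p y ->
  is_solution m r p (fun k => y k * dalembert_sum r y k).
Proof.
  intros Hr Hy Hsol k Hk.
  assert (Hq : forall j, (m <= j)%nat ->
    r j * fdiff (fun k => y k * dalembert_sum r y k) j
    = r j * fdiff y j * dalembert_sum r y j + / y j).
  { intros j Hj. unfold fdiff. simpl. field.
    generalize (Hr j Hj) (Hy j Hj) (Hy (S j) (le_S _ _ Hj)). lra. }
  unfold fdiff at 1. rewrite !Hq by lia.
  rewrite (is_solution_step _ _ _ _ _ Hsol Hk). simpl.
  unfold fdiff. field.
  generalize (Hr k Hk) (Hy k Hk) (Hy (S k) (le_S _ _ Hk)). lra.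
Qed.

(** The increment of [z / y] is the Casoratian over [r * y * y (k+1)], so the
    constant Casoratian is the coefficient of the sum. *)
Lemma solution_representation m r p y z :
  (forall k, (m <= k)%nat -> 0 < r k) -> positive_on m y ->
  is_solution m r p y -> is_solution m r p z ->
  exists a c, forall k, (m <= k)%nat ->
    z k = y k * (a + c * dalembert_sum r y k).
Proof.
  intros Hr Hy Hsol Hz.
  set (c := r m * (y m * fdiff z m - z m * fdiff y m)).
  exists (z m / y m - c * dalembert_sum r y m), c.
  intros k Hk. induction Hk as [|k Hk IH].
  - field. generalize (Hy m (le_n m)). lra.
  - assert (H1 := Hr k Hk). assert (H2 := Hy k Hk).
    assert (H3 := Hy (S k) (le_S _ _ Hk)).
    assert (Hc := casoratian_constant m r p y z m k Hsol Hz (le_n m) Hk).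
    fold c in Hc. simpl.
    set (a := z m / y m - c * dalembert_sum r y m) in *.
    replace (y (S k) * (a + c * (dalembert_sum r y k + / (r k * y k * y (S k)))))
      with (y (S k) * (a + c * dalembert_sum r y k) + c / (r k * y k))
      by (field; lra).
    replace (a + c * dalembert_sum r y k) with (z k / y k)
      by (rewrite IH; field; lra).
    rewrite <- Hc. unfold fdiff. field. lra.
Qed.

(** An affine function of a strictly increasing sequence has eventually a
    constant nonzero sign. *)
Lemma increasing_affine_eventually_sign m (s : nat -> R) a c :
  (forall k, (m <= k)%nat -> s k < s (S k)) -> a <> 0 \/ c <> 0 ->
  exists N, forall k, (N <= k)%nat -> 0 < (a + c * s k) * (a + c * s (S k)).
Proof.
  intros Hs Hac.
  assert (Hpos : forall a c, 0 < c ->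
    exists N, forall k, (N <= k)%nat -> 0 < (a + c * s k) * (a + c * s (S k))).
  { clear a c Hac. intros a c Hc.
    assert (Hinc : forall k, (m <= k)%nat -> a + c * s k < a + c * s (S k)).
    { intros k Hk. generalize (Rmult_lt_compat_l c _ _ Hc (Hs k Hk)). lra. }
    destruct (Classical_Prop.classic
      (exists K, (m <= K)%nat /\ 0 < a + c * s K)) as [(K & HK & HaK)|Hno].
    - exists K.
      assert (H : forall k, (K <= k)%nat -> 0 < a + c * s k).
      { intros k Hk. induction Hk as [|k Hk IH]; [exact HaK|].
        generalize (Hinc k (Nat.le_trans _ _ _ HK Hk)). lra. }
      intros k Hk. apply Rmult_lt_0_compat; apply H; lia.
    - exists m.
      assert (H : forall k, (m <= k)%nat -> a + c * s k < 0).
      { intros k Hk. generalize (Hinc k Hk). intros H1.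
        destruct (Rlt_or_le 0 (a + c * s (S k))) as [H2|H2]; [|lra].
        exfalso. apply Hno. exists (S k). split; [lia|exact H2]. }
      intros k Hk. apply Rmult_neg_neg; apply H; lia. }
  destruct (Rtotal_order c 0) as [Hc|[Hc|Hc]].
  - destruct (Hpos (- a) (- c)) as [N HN]; [lra|].
    exists N. intros k Hk. generalize (HN k Hk). lra.
  - exists 0%nat. intros k _. subst c. rewrite !Rmult_0_l, Rplus_0_r.
    destruct Hac as [Ha|Hc]; [|lra]. nra.
  - apply Hpos, Hc.
Qed.

Lemma positive_solution_nonosc m r p y :
  (forall k, (m <= k)%nat -> 0 < r k) -> positive_on m y ->
  is_solution m r p y -> nonosc_eq m r p.
Proof.
  intros Hr Hy Hsol z Hz (K & HK & HzK).
  destruct (solution_representation m r p y z) as (a & c & E); auto.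
  destruct (increasing_affine_eventually_sign m (dalembert_sum r y) a c)
    as [N HN].
  - intros k Hk. now apply (dalembert_sum_lt m).
  - destruct (Req_dec a 0) as [Ha|Ha]; [|now left].
    destruct (Req_dec c 0) as [Hc|Hc]; [|now right].
    exfalso. apply HzK. rewrite E, Ha, Hc by exact HK. ring.
  - exists (N + m)%nat. intros k Hk. rewrite !E by lia.
    replace (y k * (a + c * dalembert_sum r y k)
             * (y (S k) * (a + c * dalembert_sum r y (S k))))
      with (y k * y (S k) * ((a + c * dalembert_sum r y k)
             * (a + c * dalembert_sum r y (S k)))) by ring.
    apply Rmult_lt_0_compat; [apply Rmult_lt_0_compat; apply Hy; lia|].
    apply HN. lia.
Qed.

(** * Existence and minimality of a recessive solution *)

Lemma dalembert_sum_lim m r y :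
  (forall k, (m <= k)%nat -> 0 < r k) -> positive_on m y ->
  is_lim_seq (dalembert_sum r y) p_infty \/
  exists L : R, is_lim_seq (dalembert_sum r y) L /\
    forall k, (m <= k)%nat -> dalembert_sum r y k < L.
Proof.
  intros Hr Hy.
  assert (Hex : ex_lim_seq (fun n => dalembert_sum r y (n + m))).
  { apply ex_lim_seq_incr. intros n. apply Rlt_le.
    apply (dalembert_sum_lt m); auto. lia. }
  destruct Hex as [l Hl].
  apply is_lim_seq_incr_n in Hl.
  assert (Hle : forall k, (m <= k)%nat -> Rbar_le (dalembert_sum r y k) l).
  { intros k Hk.
    apply (is_lim_seq_le_loc (fun _ => dalembert_sum r y k) (dalembert_sum r y)).
    - exists k. intros n Hn. now apply (dalembert_sum_le m).
    - apply is_lim_seq_const.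
    - exact Hl. }
  destruct l as [L| |].
  - right. exists L. split; [exact Hl|]. intros k Hk.
    generalize (dalembert_sum_lt m r y k Hr Hy Hk) (Hle (S k) (le_S _ _ Hk)).
    simpl. lra.
  - now left.
  - destruct (Hle m (le_n m)).
Qed.

Lemma inv_affine_lim_zero (s : nat -> R) a c :
  is_lim_seq s p_infty -> c <> 0 -> is_lim_seq (fun k => / (a + c * s k)) 0.
Proof.
  intros Hs Hc.
  assert (Hinv : is_lim_seq (fun k => / s k) 0).
  { apply (is_lim_seq_inv s p_infty); [exact Hs|discriminate]. }
  apply is_lim_seq_ext_loc with (fun k => / s k / (a * / s k + c)).
  - assert (Hpos : eventually (fun k => 0 < s k)).
    { apply is_lim_seq_spec in Hs. exact (Hs 0). }
    destruct Hpos as [N HN]. exists N. intros k Hk.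
    assert (Hk0 := HN k Hk).
    replace (a + c * s k) with (s k * (a * / s k + c)) by (field; lra).
    unfold Rdiv. now rewrite Rinv_mult.
  - replace (Finite 0) with (Finite (0 / (a * 0 + c)))
      by (f_equal; field; lra).
    apply is_lim_seq_div'; [exact Hinv| |lra].
    apply is_lim_seq_plus'; [|apply is_lim_seq_const].
    apply (is_lim_seq_scal_l _ a 0), Hinv.
Qed.

Lemma positive_recessive_exists m r p y :
  (forall k, (m <= k)%nat -> 0 < r k) -> positive_on m y ->
  is_solution m r p y ->
  exists u, recessive m r p u /\ positive_on m u.
Proof.
  intros Hr Hy Hsol.
  assert (Hno := positive_solution_nonosc m r p y Hr Hy Hsol).
  assert (Hnt : forall u, positive_on m u -> nontrivial m u).
  { intros u Hu. exists m. split; [lia|]. generalize (Hu m (le_n m)). lra. }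
  destruct (dalembert_sum_lim m r y Hr Hy) as [Hinf|(L & HL & HltL)].
  - exists y. split; [|exact Hy].
    repeat split; auto.
    intros z Hz Hind.
    destruct (solution_representation m r p y z) as (a & c & E); auto.
    assert (Hc : c <> 0).
    { intros ->. destruct (Hind a (-1)) as [_ H]; [|lra].
      intros k Hk. rewrite (E k Hk). ring. }
    apply is_lim_seq_ext_loc with (fun k => / (a + c * dalembert_sum r y k)).
    + exists m. intros k Hk. rewrite (E k Hk). unfold Rdiv.
      rewrite Rinv_mult, <- Rmult_assoc, Rinv_r, Rmult_1_l; [reflexivity|].
      generalize (Hy k Hk). lra.
    + now apply inv_affine_lim_zero.
  - set (u := fun k => L * y k + (-1) * (y k * dalembert_sum r y k)).
    assert (Hu : positive_on m u).
    { intros k Hk. unfold u.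
      replace (L * y k + -1 * (y k * dalembert_sum r y k))
        with (y k * (L - dalembert_sum r y k)) by ring.
      apply Rmult_lt_0_compat; [auto|]. generalize (HltL k Hk). lra. }
    exists u. split; [|exact Hu].
    repeat split; auto.
    + apply is_solution_lincomb; [exact Hsol|]. now apply dalembert_solution.
    + intros z Hz Hind.
      destruct (solution_representation m r p y z) as (a & c & E); auto.
      (* If a = - c * L, then z would be the multiple - c * u of u. *)
      assert (Hc : a + c * L <> 0).
      { intros H. destruct (Hind c 1) as [_ H']; [|lra].
        intros k Hk. rewrite (E k Hk). unfold u.
        replace a with (- c * L) by lra. ring. }
      apply is_lim_seq_ext_loc with
        (fun k => (L - dalembert_sum r y k) / (a + c * dalembert_sum r y k)).
      * exists m. intros k Hk. rewrite (E k Hk). unfold u, Rdiv.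
        rewrite Rinv_mult.
        replace (L * y k + -1 * (y k * dalembert_sum r y k))
          with (y k * (L - dalembert_sum r y k)) by ring.
        assert (H : y k <> 0) by (generalize (Hy k Hk); lra).
        rewrite (Rmult_comm (y k)), Rmult_assoc.
        rewrite <- (Rmult_assoc (y k) (/ y k)), Rinv_r, Rmult_1_l; auto.
      * replace (Finite 0) with (Finite ((L - L) / (a + c * L)))
          by (f_equal; field; exact Hc).
        apply is_lim_seq_div'; [| |exact Hc].
        -- apply is_lim_seq_minus'; [apply is_lim_seq_const|exact HL].
        -- apply is_lim_seq_plus'; [apply is_lim_seq_const|].
           apply (is_lim_seq_scal_l _ c L), HL.
Qed.

(** If [z] is positive and agrees with [u] at [N] but grows more slowly there,
    the Casoratian makes [u / z] increase from 1, so [u] is not recessive. *)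
Lemma recessive_fdiff_le m r p u z N :
  (forall k, (m <= k)%nat -> 0 < r k) ->
  recessive m r p u -> is_solution m r p z -> (m <= N)%nat ->
  positive_on N z -> z N = u N -> fdiff u N <= fdiff z N.
Proof.
  intros Hr (_ & Hu & _ & Hrec) Hz HN Hzpos HzN.
  destruct (Rle_or_lt (fdiff u N) (fdiff z N)) as [H|Hlt]; [exact H|exfalso].
  assert (HzN0 := Hzpos N (le_n N)).
  assert (Hge : forall k, (N <= k)%nat -> z k <= u k).
  { intros k Hk. induction Hk as [|k Hk IH]; [lra|].
    assert (HC := casoratian_constant m r p z u N k Hz Hu HN Hk).
    assert (Hrk : 0 < r k) by (apply Hr; lia).
    assert (Hzk := Hzpos k Hk). assert (HzS := Hzpos (S k) (le_S _ _ Hk)).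
    assert (HC0 : 0 < r N * (z N * fdiff u N - u N * fdiff z N)).
    { apply Rmult_lt_0_compat; [auto|].
      rewrite <- HzN, <- Rmult_minus_distr_l.
      apply Rmult_lt_0_compat; lra. }
    rewrite <- HC in HC0.
    assert (HC1 : 0 < z k * u (S k) - u k * z (S k)).
    { apply (Rmult_lt_reg_l (r k)); [exact Hrk|].
      unfold fdiff in HC0. lra. }
    assert (z k * z (S k) <= u k * z (S k)) by (apply Rmult_le_compat_r; lra).
    apply (Rmult_le_reg_l (z k)); lra. }
  assert (Hind : lin_indep m u z).
  { intros a b Hab.
    assert (H1 := Hab N HN). assert (H2 := Hab (S N) (le_S _ _ HN)).
    rewrite (fdiff_succ u), (fdiff_succ z), HzN in H2. rewrite HzN in H1.
    assert (Hb : b = - a).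
    { apply (Rmult_eq_reg_r (u N)); lra. }
    subst b.
    assert (Ha : a = 0).
    { apply (Rmult_eq_reg_r (fdiff u N - fdiff z N)); lra. }
    lra. }
  assert (Hlim := Hrec z Hz Hind).
  assert (Hle : Rbar_le 1 0).
  { apply (is_lim_seq_le_loc (fun _ => 1) (fun k => u k / z k));
      [|apply is_lim_seq_const|exact Hlim].
    exists N. intros k Hk.
    assert (Hzk := Hzpos k Hk). assert (H := Hge k Hk).
    apply (Rmult_le_reg_r (z k)); [exact Hzk|].
    unfold Rdiv. rewrite Rmult_assoc, Rinv_l; lra. }
  simpl in Hle. lra.
Qed.

Lemma recessive_quotient_le m pA pB rA rB x u N :
  (forall k, (m <= k)%nat -> pA k <= pB k) ->
  (forall k, (m <= k)%nat -> 0 < rB k /\ rB k <= rA k) ->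
  is_solution m rB pB x -> positive_on m x ->
  recessive m rA pA u -> (m <= N)%nat -> 0 < u N ->
  rA N * fdiff u N / u N <= rB N * fdiff x N / x N.
Proof.
  intros Hp Hr Hx Hxpos Hu HN HuN.
  assert (HrA : forall k, (m <= k)%nat -> 0 < rA k).
  { intros k Hk. generalize (Hr k Hk). lra. }
  assert (HxN := Hxpos N HN).
  set (w := rB N * fdiff x N / x N).
  destruct (solution_with_data_at m rA pA N (u N) (w * u N))
    as (z & Hz & HzN & HqN); [|exact HN|].
  { intros k Hk. generalize (HrA k Hk). lra. }
  assert (Hzpos : positive_on N z).
  { apply (comparison_forward m pA pB rA rB x); auto.
    - lra.
    - rewrite HqN, HzN. apply Req_le. unfold w. field. lra. }
  assert (Hd := recessive_fdiff_le m rA pA u z N HrA Hu Hz HN Hzpos HzN).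
  apply (Rmult_le_reg_r (u N)); [exact HuN|].
  rewrite <- HqN. unfold Rdiv. rewrite Rmult_assoc, Rinv_l, Rmult_1_r by lra.
  apply Rmult_le_compat_l; [|exact Hd]. generalize (HrA N HN). lra.
Qed.

Theorem theorem1 (m : nat) (pA pB rA rB x : nat -> R)
  (hp : forall k : nat, (m <= k)%nat -> 0 <= pA k /\ pA k <= pB k)
  (hr : forall k : nat, (m <= k)%nat -> 0 < rB k /\ rB k <= rA k)
  (hB : nonosc_eq m rB pB)
  (hx : is_solution m rB pB x)
  (hxpos : positive_on m x) :
  exists u : nat -> R,
    recessive m rA pA u /\
    positive_on m u /\
    (forall k : nat, (m <= k)%nat ->
       rA k * fdiff u k / u k <= rB k * fdiff x k / x k) /\
    (decreasing_on m x -> decreasing_on m u) /\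
    (nonincreasing_on m x -> nonincreasing_on m u).
Proof.
  assert (Hp : forall k, (m <= k)%nat -> pA k <= pB k) by (intros; now apply hp).
  assert (HrA : forall k, (m <= k)%nat -> 0 < rA k).
  { intros k Hk. generalize (hr k Hk). lra. }
  assert (Hxm := hxpos m (le_n m)).
  destruct (solution_with_initial_data m rA pA (x m) (rB m * fdiff x m))
    as (y & Hy & Hym & Hqm).
  { intros k Hk. generalize (HrA k Hk). lra. }
  assert (Hypos : positive_on m y).
  { apply (comparison_forward m pA pB rA rB x); auto; [lra|].
    rewrite Hym, Hqm. lra. }
  destruct (positive_recessive_exists m rA pA y HrA Hypos Hy) as (u & Hu & Hupos).
  assert (Hle : forall k, (m <= k)%nat ->
    rA k * fdiff u k / u k <= rB k * fdiff x k / x k).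
  { intros k Hk. apply (recessive_quotient_le m pA pB); auto. }
  exists u. split; [exact Hu|]. split; [exact Hupos|]. split; [exact Hle|].
  (* The bound on fdiff u by a positive multiple of fdiff x transfers both
     signs. *)
  assert (Hsign : forall k, (m <= k)%nat ->
    exists d, 0 < d /\ fdiff u k <= d * fdiff x k).
  { intros k Hk.
    assert (H1 := HrA k Hk). assert (H2 := Hupos k Hk).
    assert (H3 := hxpos k Hk). destruct (hr k Hk) as [H4 _].
    exists (u k / rA k * (rB k / x k)). split.
    - apply Rmult_lt_0_compat; apply Rdiv_lt_0_compat; lra.
    - replace (fdiff u k) with (u k / rA k * (rA k * fdiff u k / u k))
        by (field; lra).
      replace (u k / rA k * (rB k / x k) * fdiff x k)
        with (u k / rA k * (rB k * fdiff x k / x k)) by (field; lra).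
      apply Rmult_le_compat_l; [|now apply Hle].
      apply Rlt_le, Rdiv_lt_0_compat; lra. }
  split; intros H k Hk; destruct (Hsign k Hk) as (d & Hd & Hdle);
    generalize (H k Hk); intros Hxk; nra.
Qed.
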